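(* Let $G$ be a simple bipartite graph on the vertex set $\{1,\ldots,n\}$ with $m$ edges. Then the maximum degree of a binomial in the universal Gröbner basis of $P_{G}$ is less than or equal to $\left\lfloor \frac{m+n+1}{2}\right\rfloor$.
   Context: $K$ is a field. A simple graph is a finite undirected graph without loops or multiple edges. For a simple graph $G$ on $\{1,\ldots,n\}$ with $m$ edges, let $S=K[\{x_{ij},x_{ji} : \{i,j\}\in E(G)\}\cup\{x_{ii}\}_{1\le i\le n}]$, a polynomial ring in $2m+n$ variables with the standard grading. For $i<j$ put $f_{ij}=x_{ii}x_{jj}-x_{ij}x_{ji}$; $P_G\subset S$ is the ideal generated by all $f_{ij}$ with $\{i,j\}\in E(G)$. The universal Gröbner basis of an ideal generated by binomials (differences of two monomials) is the union of all its reduced Gröbner bases (over all term orders). *)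

(* Defs.v *)
From HB Require Import structures.
From mathcomp Require Import all_boot all_order all_algebra.
From mathcomp Require Import mpoly.

Set Implicit Arguments.
Unset Strict Implicit.
Unset Printing Implicit Defensive.

Import GRing.Theory.
Local Open Scope ring_scope.

(* Vertices are 0, ..., n-1 instead of 1, ..., n. *)
Record sgraph (n : nat) := SGraph {
  adj :> rel 'I_n;
  adj_sym : ssrbool.symmetric adj;
  adj_irrefl : irreflexive adj
}.

Definition edges n (G : sgraph n) : {set {set 'I_n}} :=
  [set [set p.1; p.2] | p : 'I_n * 'I_n & G p.1 p.2].

Definition bipartite n (G : sgraph n) : Prop :=
  exists A : {set 'I_n}, forall i j, G i j -> (i \in A) != (j \in A).

Section Ideals.
Variable R : comNzRingType.

Definition ideal_gen (X : R -> Prop) (f : R) : Prop :=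
  exists s : seq (R * R),
    (forall c, c \in s -> X c.2) /\ f = \sum_(c <- s) c.1 * c.2.

End Ideals.

Section Groebner.
Variables (K : fieldType) (N : nat).
Implicit Types (le : rel 'X_{1..N}) (f g : {mpoly K[N]}) (u v w : 'X_{1..N}).
Implicit Types (I : {mpoly K[N]} -> Prop) (B : seq {mpoly K[N]}).

(* Since 0%MM is the exponent of the monomial 1, the fourth condition says
   that 1 is the least monomial; together with the others it makes [le] a
   well-ordering (Dickson's lemma). *)
Definition term_order le : Prop :=
  [/\ antisymmetric le, transitive le, total le,
      (forall u, le 0%MM u) &
      (forall u v w, le u v -> le (u + w)%MM (v + w)%MM)].

(* No [u] satisfies this when f = 0. *)
Definition is_lead le f u : Prop :=
  u \in msupp f /\ forall v, v \in msupp f -> le v u.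

Definition initial_ideal le I : {mpoly K[N]} -> Prop :=
  ideal_gen (fun g => exists f u, [/\ I f, is_lead le f u & g = 'X_[u]]).

Definition groebner_basis le I B : Prop :=
  (forall g, g \in B -> I g) /\
  (forall f, initial_ideal le I f <->
     ideal_gen (fun h => exists g u,
       [/\ g \in B, is_lead le g u & h = 'X_[u]]) f).

Definition reduced_groebner_basis le I B : Prop :=
  [/\ groebner_basis le I B,
      (forall g, g \in B -> exists2 u, is_lead le g u & g@_u = 1) &
      (forall g h u v, g \in B -> h \in B -> g != h ->
         is_lead le h u -> v \in msupp g -> ~~ (u <= v)%MM)].

Definition universal_groebner_basis I f : Prop :=
  exists le B, [/\ term_order le, reduced_groebner_basis le I B & f \in B].

End Groebner.

Section EdgeIdeal.
Variables (K : fieldType) (n : nat) (G : sgraph n).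

Definition is_var (p : 'I_n * 'I_n) : bool := (p.1 == p.2) || G p.1 p.2.

Lemma is_var_diag i : is_var (i, i).
Proof. by rewrite /is_var eqxx. Qed.

Lemma is_var_edge i j : G i j -> is_var (i, j).
Proof. by rewrite /is_var /= => ->; rewrite orbT. Qed.

Lemma is_var_edge_sym i j : G i j -> is_var (j, i).
Proof. by move=> e; apply: is_var_edge; rewrite adj_sym. Qed.

(* An edge {i, j} contributes both (i, j) and (j, i), so with m edges there
   are 2m + n variables. *)
Definition var : finType := {p : 'I_n * 'I_n | is_var p}.

Definition x (p : 'I_n * 'I_n) (hp : is_var p) : {mpoly K[#|{: var}|]} :=
  'X_(enum_rank (Sub p hp : var)).

Definition edge_minor i j (e : G i j) : {mpoly K[#|{: var}|]} :=
  x (is_var_diag i) * x (is_var_diag j)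
    - x (is_var_edge e) * x (is_var_edge_sym e).

Definition PG : {mpoly K[#|{: var}|]} -> Prop :=
  ideal_gen (fun g => exists (i j : 'I_n) (e : G i j),
               (i < j)%N /\ g = edge_minor e).

End EdgeIdeal.

Arguments PG K {n} G.

(* The total degree of a nonzero polynomial; [msize] is one more. *)
Definition deg (K : fieldType) N (f : {mpoly K[N]}) : nat := (msize f).-1.

(* Main.v *)
Require Import Defs.
From mathcomp Require Import all_boot all_order all_algebra.
From mathcomp Require Import mpoly ssrcomplements zify.

(** The ideal P_G is the toric ideal of a fine grading in which a monomial
    records, for every vertex i, the total exponent of the variables
    [x_ij] with j ranging over i and its neighbours, and for every edge ij the
    difference of the exponents of [x_ij] and [x_ji].  Between two
    monomials of equal fine degree, the exponents of [x_ij] and [x_ji] change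
    by the same integer [c_e] for each edge e = ij, and the exponent of [x_ii]
    by minus the sum of the [c_e] over the edges at i.

    Let f be an element of a reduced Groebner basis, with leading monomial u.
    Every other monomial of f is standard, that is, not in the initial ideal.
    The coefficients of an element of P_G sum to zero over each fine degree
    ([PG_class_sum]), while a difference of two monomials of the same fine
    degree lies in P_G ([PG_binomial]).  Two distinct standard monomials
    therefore never share a fine degree, so all the monomials of f have the
    fine degree of u, hence the total degree of u, and some v other than u is
    among them.

    It remains to bound the degree of u.  As G is bipartite, with a side A, the
    integers [c_e] that lead from u to v orient the edges: a positive [c_e] sends e
    from A to its complement, a negative one the other way, so the change at
    [x_ii] is the net flow at i up to sign.  This digraph contains either a
    simple cycle, or a simple path from a source to a sink ([exists_thread]).
    Its arcs, each with coefficient 1 or -1, define monomials u' dividing u and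
    v' dividing v of equal fine degree ([conformal_pair]).  This is the
    conformal decomposition that, for a totally unimodular matrix, makes the
    Graver basis consist of circuits.  The leading monomial of
    X^u' - X^v' cannot be v', which divides the standard monomial v; it is u',
    and u' = u because u is a minimal generator of the initial ideal.  Finally
    the degree of u' is the number t of vertices on the cycle or path, so
    t <= n and t - 1 <= m give 2t <= m + n + 1. *)

Set Implicit Arguments.
Unset Strict Implicit.
Unset Printing Implicit Defensive.

Import GRing.Theory.

(** * Simple cycles and source-to-sink paths in a digraph *)

Section Thread.
Variables (T : finType) (D : rel T).

Definition arc_out (F : rel T) i := [exists j, F i j].
Definition arc_in (F : rel T) i := [exists j, F j i].

(** Cycles and paths are treated together, as sets of arcs F in which every
    vertex has at most one successor and one predecessor.  At a vertex where F
    starts or ends, D has to start or end too: this is what makes the flow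
    along F conformal to the flow along D.  The last clause is the trace left by
    connectedness on the counts: all the vertices of F but at most one are the
    tail of an arc of F, so F has at most one vertex more than it has arcs. *)
Definition thread (F : rel T) : Prop :=
  [/\ subrel F D,
      (forall i j k, F i j -> F i k -> j = k) /\
      (forall i j k, F i k -> F j k -> i = j),
      (forall i, arc_out F i -> ~~ arc_in F i -> ~~ arc_in D i) /\
      (forall i, arc_in F i -> ~~ arc_out F i -> ~~ arc_out D i),
      (exists i, arc_out F i) &
      #|[pred i | arc_out F i || arc_in F i]| <= #|arc_out F|.+1].

Lemma arc_outI (F : rel T) i j : F i j -> arc_out F i.
Proof. by move=> Fij; apply/existsP; exists j. Qed.

Lemma arc_inI (F : rel T) i j : F i j -> arc_in F j.
Proof. by move=> Fij; apply/existsP; exists i. Qed.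

Lemma next_last x p : uniq (x :: p) -> next (x :: p) (last x p) = x :> T.
Proof.
move=> us; rewrite next_nth mem_last index_last //.
by rewrite nth_default.
Qed.

Lemma cycle_thread x p : uniq (x :: p) -> cycle D (x :: p) ->
  exists F, thread F.
Proof.
set s := x :: p => us cs.
pose F i j := (i \in s) && (next s i == j).
have Fnext i : i \in s -> F i (next s i) by rewrite /F eqxx andbT.
have Fprev i : i \in s -> F (prev s i) i.
  by rewrite /F mem_prev next_prev // eqxx andbT.
exists F; split.
- by move=> i j /andP[si /eqP <-]; apply: next_cycle.
- split=> [i j k /andP[_ /eqP <-] /andP[_ /eqP <-] //|i j k].
  by move=> /andP[_ /eqP <-] /andP[_ /eqP /(can_inj (prev_next us))].
- split=> i /existsP[j /andP[si /eqP nj]] /existsPn no; last first.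
    by have := no (next s i); rewrite Fnext // -nj mem_next.
  by have := no (prev s i); rewrite Fprev.
- by exists x; apply/existsP; exists (next s x); rewrite Fnext ?mem_head.
apply/leqW/subset_leq_card/subsetP => i; rewrite !inE => /orP[//|].
case/existsP=> j /andP[sj /eqP nj]; apply: arc_outI (Fnext i _).
by rewrite -nj mem_next.
Qed.

(** The successor along the path is [next], the cyclic successor, deprived of
    the value x that it takes at the last vertex. *)
Lemma path_thread x p : uniq (x :: p) -> path D x p -> p != [::] ->
  ~~ arc_in D x -> ~~ arc_out D (last x p) -> exists F, thread F.
Proof.
set s := x :: p => us ps pN0 srcx snkl.
pose F i j := [&& i \in s, next s i == j & j != x].
have Fnext i : i \in s -> i != last x p -> F i (next s i).
  move=> si il; rewrite /F si eqxx !andTb; apply: contra il => /eqP nx.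
  by apply/eqP/(can_inj (prev_next us)); rewrite nx next_last.
have Fprev i : i \in s -> i != x -> F (prev s i) i.
  by rewrite /F mem_prev next_prev // eqxx => -> ->.
have xl : x != last x p.
  move: us; rewrite /s cons_uniq => /andP[xp _]; case: (p) pN0 xp => // y q _.
  by apply: contra => /eqP {1}->; apply: mem_last y q.
exists F; split.
- (* Admitting the closing arc turns the path into a cycle. *)
  have cs : cycle (fun i j => D i j || (j == x)) s.
    rewrite /= rcons_path eqxx orbT andbT.
    by apply: sub_path ps => i j ->.
  move=> i j /and3P[si /eqP <-] /negPf jx.
  by have := next_cycle cs si; rewrite jx orbF.
- split=> [i j k /and3P[_ /eqP <- _] /and3P[_ /eqP <-] //|i j k].
  by move=> /and3P[_ /eqP <- _] /and3P[_ /eqP /(can_inj (prev_next us))].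
- split=> i /existsP[j /and3P[sj /eqP nj jx]] no.
    case: (eqVneq i x) => [->//|ix].
    by rewrite (arc_inI (Fprev _ sj ix)) in no.
  case: (eqVneq i (last x p)) => [->//|il].
  have si : i \in s by rewrite -nj mem_next.
  by rewrite (arc_outI (Fnext _ si il)) in no.
- by exists x; apply: arc_outI (Fnext _ (mem_head _ _) xl).
apply: (@leq_trans #|[predU1 (last x p) & arc_out F]|).
  apply/subset_leq_card/subsetP => i; rewrite !inE.
  have [-> //|il] /= := eqVneq i (last x p).
  case/orP=> [//|/existsP[j /and3P[sj /eqP nj _]]].
  by apply: arc_outI (Fnext i _ il); rewrite -nj mem_next.
by rewrite cardU1; case: (_ \in _).
Qed.

(** Without a cycle, a simple path of maximal length starts at a source and
    ends at a sink: an arc into its first vertex (or out of its last one) would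
    either lengthen it or close a cycle. *)
Lemma exists_thread : (forall i, ~~ D i i) -> (exists i j, D i j) ->
  exists F, thread F.
Proof.
move=> Dirr [a [b Dab]].
case: (boolP [exists y, exists z, D y z && connect D z y]).
  case/existsP=> y /existsP[z /andP[Dyz /connectP[p0 pz ey]]] {a b Dab}.
  move: Dyz; rewrite {}ey; have [p pp us _] := shortenP pz => Dyz.
  by apply: (cycle_thread us); rewrite /= rcons_path pp.
move=> acyc.
have {}acyc y z : D y z -> ~~ connect D z y.
  move=> Dyz; apply: contra acyc => c.
  by apply/existsP; exists y; apply/existsP; exists z; rewrite Dyz.
pose P k := [exists t : k.-tuple T, uniq t && sorted D t].
have P2 : exists k, P k.
  exists 2; apply/existsP; exists [tuple a; b]; rewrite /= Dab !andbT inE.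
  by apply: contraL Dab => /eqP ->.
have Pmax k : P k -> k <= #|T|.
  case/existsP=> t /andP[ut _].
  by have := max_card (mem t); rewrite (card_uniqP ut) size_tuple.
have [k /existsP[t /andP[ut st]] kmax] := ex_maxnP P2 Pmax.
have longest s : uniq s -> sorted D s -> size s <= k.
  by move=> us ss; apply: kmax; apply/existsP; exists (in_tuple s); rewrite us.
have k2 : 1 < k.
  apply: (longest [:: a; b]); rewrite /= ?Dab ?inE ?andbT //.
  by apply: contraL Dab => /eqP ->.
move: ut st k2 (size_tuple t); case: (tval t) => [|x [|y p]] //.
- by move=> _ _ + ek; rewrite -ek.
- by move=> _ _ + ek; rewrite -ek.
set q := y :: p => us + _ ek; rewrite -[sorted _ _]/(path D x q) => ps.
apply: (path_thread us ps) => //.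
  apply/existsP=> -[z Dzx]; case: (boolP (z \in x :: q)) => [sz|nsz].
    case/negP: (acyc _ _ Dzx); exact: path_connect ps _ sz.
  suff: size (z :: x :: q) <= k by rewrite -ek ltnn.
  by apply: longest; [rewrite cons_uniq nsz | rewrite /= Dzx].
apply/existsP=> -[z Dlz]; case: (boolP (z \in x :: q)) => [sz|nsz].
  case/negP: (acyc _ _ Dlz); case/splitPl: sz ps => p1 p2 <-.
  by rewrite cat_path last_cat => /andP[_ p2p]; apply/connectP; exists p2.
suff: size (rcons (x :: q) z) <= k by rewrite size_rcons -ek ltnn.
apply: longest; first by rewrite rcons_uniq nsz.
by rewrite -[sorted _ _]/(path D x (rcons q z)) rcons_path ps.
Qed.
End Thread.

Lemma eq_thread (T : finType) (D D' F : rel T) :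
  D =2 D' -> thread D F -> thread D' F.
Proof.
move=> DD' [FD Funiq [Fsrc Fsnk] Fex Fcard]; split=> //.
  by move=> i j /FD; rewrite DD'.
split=> i.
  move=> oi ni; have := Fsrc i oi ni; rewrite /arc_in.
  by under eq_existsb do rewrite DD'.
move=> ii ni; have := Fsnk i ii ni; rewrite /arc_out.
by under eq_existsb do rewrite DD'.
Qed.

(** * Exponent vectors and the fine grading *)

Section Exponents.
Variables (n : nat) (G : sgraph n).
Local Notation N := #|{: var G}|.
Implicit Types (u v w : 'X_{1..N}) (i j : 'I_n).

(** The exponent of the variable (i, j), extended by 0 to the pairs (i, j)
    that carry no variable, so that sums may range over all pairs. *)
Definition expo u i j : nat :=
  if insub (i, j) is Some p then u (enum_rank (p : var G)) else 0.

Definition mnm_of (e : 'I_n -> 'I_n -> nat) : 'X_{1..N} :=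
  [multinom e (val (enum_val k)).1 (val (enum_val k)).2 | k < N].

Lemma expo_rank u (p : var G) : expo u (val p).1 (val p).2 = u (enum_rank p).
Proof. by rewrite /expo -surjective_pairing valK. Qed.

Lemma expo_val u k : u k = expo u (val (enum_val k)).1 (val (enum_val k)).2.
Proof. by rewrite expo_rank enum_valK. Qed.

Lemma expo_nvar u i j : ~~ is_var G (i, j) -> expo u i j = 0.
Proof. by rewrite /expo => ?; rewrite insubN. Qed.

Lemma expo_mnm_of e i j : expo (mnm_of e) i j = if is_var G (i, j) then e i j else 0.
Proof.
rewrite /expo; case: insubP => [p -> vp|/negPf -> //].
by rewrite mnmE enum_rankK vp.
Qed.

Lemma expo_inj u v : expo u =2 expo v -> u = v.
Proof. by move=> uv; apply/mnmP => k; rewrite !expo_val uv. Qed.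

Lemma lem_expo u v : (forall i j, expo u i j <= expo v i j) -> (u <= v)%MM.
Proof. by move=> uv; apply/mnm_lepP => k; rewrite !expo_val. Qed.

Lemma expoD u v i j : expo (u + v)%MM i j = expo u i j + expo v i j.
Proof. by rewrite /expo; case: insubP => // p _ _; rewrite mnmDE. Qed.

Lemma expo1 (p : var G) i j : expo U_(enum_rank p)%MM i j = (val p == (i, j)).
Proof.
rewrite /expo; case: insubP => [q _ <-|/negP nij].
  by rewrite mnm1E (inj_eq enum_rank_inj) val_eqE.
by case: eqP => // ep; case: nij; rewrite -ep (valP p).
Qed.

Lemma mdeg_expo u : mdeg u = \sum_i \sum_j expo u i j.
Proof.
rewrite mdegE pair_big /=.
rewrite (reindex (@enum_rank (var G))); last by apply/onW_bij/enum_rank_bij.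
rewrite (bigID (is_var G)) /= [X in (_ + X)%N]big1 ?addn0; last first.
  by move=> [i j] nij; rewrite /= expo_nvar.
rewrite [RHS](big_sub (is_var G)) /=.
by apply: eq_bigr => p _; rewrite -expo_rank.
Qed.

(** Equality of the fine degrees.  The equation on differences is written
    without subtraction; it is void unless ij is an edge. *)
Definition fine_equiv u v : bool :=
  [forall i, \sum_j expo u i j == \sum_j expo v i j] &&
  [forall i, forall j,
     expo u i j + expo v j i == expo v i j + expo u j i].

Lemma fine_equivP u v :
  reflect ((forall i, \sum_j expo u i j = \sum_j expo v i j) /\
           (forall i j, expo u i j + expo v j i = expo v i j + expo u j i))
          (fine_equiv u v).
Proof.
apply: (iffP andP) => -[H1 H2]; split.
- by move=> i; apply/eqP/(forallP H1).
- by move=> i j; apply/eqP; move/forallP/(_ i)/forallP: H2.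
- by apply/forallP => i; apply/eqP.
- by apply/forallP => i; apply/forallP => j; apply/eqP.
Qed.

Lemma fine_equiv_refl u : fine_equiv u u.
Proof. by apply/fine_equivP. Qed.

Lemma fine_equiv_sym u v : fine_equiv u v = fine_equiv v u.
Proof. by apply/fine_equivP/fine_equivP => -[H1 H2]; split=> *; rewrite ?H1 ?H2. Qed.

Lemma fine_equiv_trans u v w : fine_equiv u v -> fine_equiv v w -> fine_equiv u w.
Proof.
move=> /fine_equivP[H1 H2] /fine_equivP[H3 H4]; apply/fine_equivP; split.
  by move=> i; rewrite H1.
by move=> i j; move: (H2 i j) (H4 i j); lia.
Qed.

Lemma fine_equivD u v w : fine_equiv (u + w)%MM (v + w)%MM = fine_equiv u v.
Proof.
apply/fine_equivP/fine_equivP => -[H1 H2]; split=> [i|i j].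
- move: (H1 i).
  under eq_bigr do rewrite expoD; rewrite big_split /=.
  under [in RHS]eq_bigr do rewrite expoD; rewrite big_split /=; lia.
- by move: (H2 i j); rewrite !expoD; lia.
- under eq_bigr do rewrite expoD; rewrite big_split /=.
  under [in RHS]eq_bigr do rewrite expoD; by rewrite big_split /= H1.
- by move: (H2 i j); rewrite !expoD; lia.
Qed.

Lemma mdeg_fine_equiv u v : fine_equiv u v -> mdeg u = mdeg v.
Proof.
by case/fine_equivP => H _; rewrite !mdeg_expo; apply: eq_bigr => i _.
Qed.

(** The row sums determine the exponents of the diagonal variables from the
    others. *)
Lemma fine_equiv_edges_inj u v : fine_equiv u v ->
  (forall i j, G i j -> expo u i j = expo v i j) -> u = v.
Proof.
move=> /fine_equivP[row _] edge.
have off i j : i != j -> expo u i j = expo v i j.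
  move=> ij; case: (boolP (G i j)) => [/edge //|nG].
  by rewrite !expo_nvar // /is_var negb_or /= nG ij.
apply: expo_inj => i j; have [<-|/off //] := eqVneq i j.
move: (row i); rewrite (bigD1 i) //= [RHS](bigD1 i) //=.
under eq_bigr => k ki do rewrite off 1?eq_sym //.
by move/addIn.
Qed.

(** When i is a source or a sink of the flow, the exponents along the edges at
    i change in one direction only, and the row sum of i forces [x_ii] to
    compensate. *)
Lemma expo_diag_gt0 u v i j : fine_equiv u v ->
  (forall k, G i k -> expo u i k <= expo v i k) ->
  G i j -> expo u i j < expo v i j -> 0 < expo u i i.
Proof.
move=> /fine_equivP[/(_ i) row _] le Gij lt.
have ji : j != i by apply: contraL Gij => /eqP ->; rewrite adj_irrefl.
have split w : \sum_k expo w i k = expo w i i +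
    (expo w i j + \sum_(k < n | (k != i) && (k != j)) expo w i k).
  by rewrite (bigD1 i) //= (bigD1 j).
move: row; rewrite !split.
suff : \sum_(k < n | (k != i) && (k != j)) expo u i k <=
  \sum_(k < n | (k != i) && (k != j)) expo v i k by lia.
apply: leq_sum => k /andP[ki _]; case: (boolP (G i k)) => [/le //|nG].
by rewrite expo_nvar // /is_var /= negb_or nG eq_sym ki.
Qed.

Lemma sum_nat_uniq (T : finType) (P : pred T) :
  (forall x y, P x -> P y -> x = y) -> \sum_x (P x : nat) = [exists x, P x].
Proof.
move=> uP; case: (boolP [exists x, P x]) => [/existsP[i Pi]|/existsPn nP].
  rewrite (bigD1 i) //= Pi big1 // => j ji.
  by case: (boolP (P j)) ji => // /uP /(_ Pi) ->; rewrite eqxx.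
by rewrite big1 // => i _; rewrite (negPf (nP i)).
Qed.

(** Sending each tail to its arc, seen as an edge, is injective since F never
    traverses an edge in both directions. *)
Lemma card_arc_out (F : rel 'I_n) : subrel F G ->
  (forall i j, F i j -> ~~ F j i) ->
  (forall i j k, F i j -> F i k -> j = k) -> #|arc_out F| <= #|edges G|.
Proof.
move=> FG asF funF.
pose f i := odflt i [pick j | F i j].
have Ff i : arc_out F i -> F i (f i).
  move=> /existsP[j Fij]; rewrite /f; case: pickP => [//|/(_ j)].
  by rewrite Fij.
rewrite -(@card_in_imset _ _ (fun i => [set i; f i])).
  apply/subset_leq_card/subsetP => e /imsetP[i oi ->].
  by apply/imsetP; exists (i, f i) => //; rewrite inE; apply/FG/Ff.
move=> i j /Ff Fi /Ff Fj eij.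
have: i \in [set j; f j] by rewrite -eij set21.
have: j \in [set i; f i] by rewrite eij set21.
rewrite !inE => /orP[/eqP -> // | /eqP ej] /orP[/eqP //| /eqP ei].
by rewrite -ej in Fi; rewrite -ei in Fj; rewrite (negPf (asF _ _ Fj)) in Fi.
Qed.

(** The change from u to v, of the same sign on the two variables of an edge,
    read as a flow: an edge whose exponents increase is directed out of A, one
    whose exponents decrease is directed into A. *)
Definition flow (A : {set 'I_n}) u v : rel 'I_n := fun i j =>
  G i j && (if i \in A then expo u i j < expo v i j else expo v i j < expo u i j).

Lemma flowC A u v : flow (~: A) v u =2 flow A u v.
Proof. by move=> i j; rewrite /flow inE; case: (i \in A). Qed.

(** The exponents on the u side of the pair attached to a set of arcs F.  An
    arc entering A contributes its two variables, and an arc leaving A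
    contributes nothing here; at the ends of F the diagonal variables balance
    the row sums.  The v side is the same construction for the complement of A. *)
Definition thread_expo (A : {set 'I_n}) (F : rel 'I_n) i j : nat :=
  if i == j
  then (if i \in A then arc_out F i && ~~ arc_in F i
        else arc_in F i && ~~ arc_out F i)
  else (if i \in A then F j i else F i j).

Section Bipartition.
Variable A : {set 'I_n}.
Hypothesis bipA : forall i j, G i j -> (i \in A) != (j \in A).

Lemma flow_in u v i j : fine_equiv u v -> flow A u v j i = G i j &&
  (if i \in A then expo v i j < expo u i j else expo u i j < expo v i j).
Proof.
case/fine_equivP=> _ /(_ i j) dif.
rewrite /flow adj_sym; case: (boolP (G i j)) => //= /bipA.
by move: dif; case: (i \in A); case: (j \in A) => //= *; lia.
Qed.

Lemma flow_asym u v i j : fine_equiv u v -> flow A u v i j -> ~~ flow A u v j i.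
Proof.
by move=> uv; rewrite [flow _ _ _ j i]flow_in // /flow;
  case: (G i j) => //=; case: (i \in A); lia.
Qed.

Lemma exists_flow u v : fine_equiv u v -> u != v -> exists i j, flow A u v i j.
Proof.
move=> uv neq.
case: (boolP [exists i, exists j, G i j && (expo u i j != expo v i j)]).
  case/existsP=> i /existsP[j /andP[Gij ne]].
  case: (boolP (flow A u v i j)) => [|nD]; first by exists i, j.
  exists j, i; move: nD ne; rewrite [flow _ _ _ j i]flow_in // /flow Gij /=.
  by case: ifP => _; lia.
move=> noex; case/eqP: neq; apply: fine_equiv_edges_inj uv _ => i j Gij.
apply/eqP; apply: contraNT noex => ne.
by apply/existsP; exists i; apply/existsP; exists j; rewrite Gij.
Qed.

Section Subgraph.
Variable F : rel 'I_n.
Hypothesis FG : subrel F G.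

Lemma expo_thread_mnm i j :
  expo (mnm_of (thread_expo A F)) i j = thread_expo A F i j.
Proof.
rewrite expo_mnm_of; case: (boolP (is_var _ _)) => //.
rewrite /is_var negb_or /= /thread_expo => /andP[/negPf -> nG].
have -> : F i j = false by apply/negbTE; apply: contra nG => /FG.
have -> : F j i = false by apply/negbTE; apply: contra nG => /FG; rewrite adj_sym.
by rewrite if_same.
Qed.

Lemma thread_expo_sym i j : thread_expo A F i j = thread_expo A F j i.
Proof.
rewrite /thread_expo eq_sym; case: (eqVneq j i) => [-> //|_].
have: F i j || F j i -> (i \in A) != (j \in A).
  by case/orP=> /FG /bipA //; rewrite eq_sym.
by case: (F i j); case: (F j i); case: (i \in A); case: (j \in A) => //= /(_ isT).
Qed.

(** The row sum does not depend on A: this is why the two sides of the pair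
    have the same fine degree. *)
Lemma row_thread_expo i :
  (forall i j k, F i j -> F i k -> j = k) ->
  (forall i j k, F i k -> F j k -> i = j) ->
  \sum_j thread_expo A F i j = (arc_out F i || arc_in F i).
Proof.
move=> Fout Fin.
have Fii : F i i = false by apply/negbTE/negP => /FG; rewrite adj_irrefl.
have outF : \sum_(j < n | j != i) F i j = arc_out F i.
  have <- : \sum_j F i j = arc_out F i by apply: sum_nat_uniq; apply: Fout.
  by rewrite [RHS](bigD1 i) //= Fii.
have inF : \sum_(j < n | j != i) F j i = arc_in F i.
  have <- : \sum_j F j i = arc_in F i by apply: sum_nat_uniq => j k; apply: Fin.
  by rewrite [RHS](bigD1 i) //= Fii.
rewrite (bigD1 i) //= {1}/thread_expo eqxx.
rewrite (eq_bigr (fun j => (if i \in A then F j i else F i j) : nat)); last first.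
  by move=> j ji; rewrite /thread_expo eq_sym (negPf ji).
by case: (i \in A); rewrite ?outF ?inF; case: (arc_out F i) (arc_in F i) => [] [].
Qed.
End Subgraph.

Lemma thread_mnm_le u v F : fine_equiv u v -> thread (flow A u v) F ->
  (mnm_of (thread_expo A F) <= u)%MM.
Proof.
move=> uv [FD _ [Fsrc Fsnk] _ _].
have FG : subrel F G by move=> i j /FD/andP[].
apply: lem_expo => i j; rewrite expo_thread_mnm // /thread_expo.
case: eqVneq => [<-|_]; case: (boolP (i \in A)) => iA.
- case: (boolP (_ && _)) => // /andP[oi ni].
  have /existsP[k /FD] := oi; rewrite /flow iA => /andP[Gik lt].
  apply: (expo_diag_gt0 uv _ Gik lt) => l Gil.
  have /existsPn/(_ l) := Fsrc i oi ni.
  by rewrite flow_in // Gil iA -leqNgt.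
- case: (boolP (_ && _)) => // /andP[ii ni].
  have /existsP[k /FD] := ii; rewrite flow_in // (negPf iA) => /andP[Gik lt].
  apply: (expo_diag_gt0 uv _ Gik lt) => l Gil.
  have /existsPn/(_ l) := Fsnk i ii ni.
  by rewrite /flow Gil (negPf iA) -leqNgt.
- case: (boolP (F j i)) => // /FD.
  by rewrite flow_in // iA => /andP[_]; apply: leq_ltn_trans.
case: (boolP (F i j)) => // /FD.
by rewrite /flow (negPf iA) => /andP[_]; apply: leq_ltn_trans.
Qed.
End Bipartition.

(** The combinatorial core of the degree bound.  The v side of the pair is
    handled by exchanging u with v and A with its complement, which leaves the
    flow unchanged. *)
Lemma conformal_pair u v : bipartite G -> fine_equiv u v -> u != v ->
  exists u' v', [/\ (u' <= u)%MM, (v' <= v)%MM, fine_equiv u' v', u' != v' &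
    (mdeg u').*2 <= #|edges G| + n + 1].
Proof.
move=> [A bipA] uv neq.
have bipC i j : G i j -> (i \in ~: A) != (j \in ~: A).
  by rewrite !inE => /bipA; case: (i \in A); case: (j \in A).
have Dirr i : ~~ flow A u v i i by rewrite /flow adj_irrefl.
have [F thF] := exists_thread Dirr (exists_flow bipA uv neq).
have [FD [Fout Fin] _ [i oi] Fcard] := thF.
have FG : subrel F G by move=> j k /FD/andP[].
have Fasym j k : F j k -> ~~ F k j.
  by move=> /FD/(flow_asym bipA uv); apply: contra => /FD.
have expoF B := @expo_thread_mnm B F FG.
have rowF B j : \sum_k expo (mnm_of (thread_expo B F)) j k =
    (arc_out F j || arc_in F j).
  by rewrite (eq_bigr _ (fun k _ => expoF B j k)) row_thread_expo.
exists (mnm_of (thread_expo A F)), (mnm_of (thread_expo (~: A) F)); split.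
- exact: thread_mnm_le thF.
- apply: (thread_mnm_le bipC (v := u)); first by rewrite fine_equiv_sym.
  by apply: eq_thread thF => j k; rewrite flowC.
- apply/fine_equivP; split=> [j|j k]; first by rewrite !rowF.
  by rewrite !expoF (thread_expo_sym bipA) // (thread_expo_sym bipC) // addnC.
- (* The two monomials differ on the variables of any arc of F. *)
  have /existsP[j Fij] := oi; apply/eqP => /(congr1 (fun w => expo w i j)).
  rewrite !expoF /thread_expo inE Fij (negPf (Fasym _ _ Fij)).
  case: eqP Fij => [-> /FG|_ _]; first by rewrite adj_irrefl.
  by case: ifP.
have -> : mdeg (mnm_of (thread_expo A F)) = #|[pred i | arc_out F i || arc_in F i]|.
  rewrite mdeg_expo -sum1_card [RHS]big_mkcond /=; apply: eq_bigr => j _.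
  by rewrite rowF inE; case: (_ || _).
have card_n : #|[pred i | arc_out F i || arc_in F i]| <= n.
  by rewrite -[X in _ <= X]card_ord max_card.
by have := card_arc_out FG Fasym Fout; move: Fcard; lia.
Qed.
End Exponents.

(** * Ideals, linear functionals and reduced Groebner bases *)

Section IdealGen.
Local Open Scope ring_scope.
Variable R : comNzRingType.
Implicit Types (X : R -> Prop) (f g : R).

Lemma ideal_gen_mem X f : X f -> ideal_gen X f.
Proof.
move=> Xf; exists [:: (1, f)]; rewrite big_seq1 mul1r; split=> // c.
by rewrite inE => /eqP ->.
Qed.

Lemma ideal_gen0 X : ideal_gen X 0.
Proof. by exists [::]; rewrite big_nil; split. Qed.

Lemma ideal_genD X f g : ideal_gen X f -> ideal_gen X g -> ideal_gen X (f + g).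
Proof.
move=> [s [sX ->]] [t [tX ->]]; exists (s ++ t); rewrite big_cat; split=> // c.
by rewrite mem_cat => /orP[/sX|/tX].
Qed.

Lemma ideal_genM X f g : ideal_gen X g -> ideal_gen X (f * g).
Proof.
move=> [s [sX ->]]; exists [seq (f * c.1, c.2) | c <- s]; split.
  by move=> _ /mapP[c /sX Xc ->].
by rewrite big_map mulr_sumr; apply: eq_bigr => c _; rewrite mulrA.
Qed.

Lemma ideal_genN X f : ideal_gen X f -> ideal_gen X (- f).
Proof. by move=> /(ideal_genM (-1)); rewrite mulN1r. Qed.
End IdealGen.

Section Weight.
Local Open Scope ring_scope.
Variables (K : fieldType) (N : nat) (phi : 'X_{1..N} -> K).
Implicit Types f g : {mpoly K[N]}.

(** The linear functional on polynomials taking the value [phi w] at the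
    monomial w. *)
Definition weight f : K := \sum_(w <- msupp f) f@_w * phi w.

Lemma weightwE f k : (msize f <= k)%N ->
  weight f = \sum_(w : 'X_{1..N < k}) f@_w * phi w.
Proof.
move=> le_fk; pose S : subFinType _ := 'X_{1..N < k}.
rewrite /weight (big_mksub S) //=; first last.
- by move=> w /msize_mdeg_lt /leq_trans; apply.
- exact: msupp_uniq.
by rewrite big_rmcond //= => w /memN_msupp_eq0 ->; rewrite mul0r.
Qed.

Lemma weightD f g : weight (f + g) = weight f + weight g.
Proof.
pose k := maxn (msize (f + g)) (maxn (msize f) (msize g)).
rewrite !(@weightwE _ k) ?leq_max ?leqnn ?orbT //.
by rewrite -big_split; apply: eq_bigr => w _; rewrite mcoeffD mulrDl.
Qed.

Lemma weight0 : weight 0 = 0.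
Proof. by rewrite /weight msupp0 big_nil. Qed.

Lemma weightZX a w : weight (a *: 'X_[w]) = a * phi w.
Proof.
have [->|a0] := eqVneq a 0; first by rewrite scale0r weight0 mul0r.
by rewrite /weight msuppMCX // big_seq1 mcoeffZ mcoeffX eqxx mulr1.
Qed.

Lemma weight_sum (I : Type) (r : seq I) F :
  weight (\sum_(i <- r) F i) = \sum_(i <- r) weight (F i).
Proof. exact: (big_morph weight weightD weight0). Qed.

Lemma weight_binomial_multiple f a b :
  (forall w, phi (w + a)%MM = phi (w + b)%MM) ->
  weight (f * ('X_[a] - 'X_[b])) = 0.
Proof.
move=> phiE; rewrite [f]mpolyE mulr_suml weight_sum big1 // => w _.
rewrite -scalerAl mulrBr -!mpolyXD scalerBr -scaleNr weightD !weightZX.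
by rewrite mulNr phiE subrr.
Qed.
End Weight.

Section ReducedGroebner.
Local Open Scope ring_scope.
Variables (K : fieldType) (N : nat) (le : rel 'X_{1..N}).
Variables (I : {mpoly K[N]} -> Prop) (B : seq {mpoly K[N]}).
Hypotheses (to_le : term_order le) (redB : reduced_groebner_basis le I B).
Implicit Types (f g h : {mpoly K[N]}) (u v w : 'X_{1..N}).

Lemma lem_term_order u v : (u <= v)%MM -> le u v.
Proof.
case: to_le => _ _ _ le0 leD uv.
by have := leD _ _ u (le0 (v - u)%MM); rewrite add0m submK.
Qed.

Lemma mem_ideal_of_monomials (U : 'X_{1..N} -> Prop) w :
  ideal_gen (fun h : {mpoly K[N]} => exists2 u, U u & h = 'X_[u]) 'X_[w] ->
  exists2 u, U u & (u <= w)%MM.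
Proof.
case=> s [sU Xw].
have : w \in msupp (\sum_(c <- s) c.1 * c.2) by rewrite -Xw msuppX inE.
move=> /msupp_sum_le /flatten_mapP[c]; rewrite filter_predT => /sU[u Uu ->].
rewrite (perm_mem (msuppMX _ _)) => /mapP[v _ ->].
by exists u => //; apply: lem_addr.
Qed.

(** This is the usual divisibility property of Groebner bases, extracted from
    the equality of the initial ideal and the ideal of the leading
    monomials. *)
Lemma lead_divisible h w : I h -> is_lead le h w ->
  exists g u, [/\ g \in B, is_lead le g u & (u <= w)%MM].
Proof.
move=> Ih hw; case: redB => -[_ gb] _ _.
have /gb : initial_ideal le I 'X_[w] by apply: ideal_gen_mem; exists h, w.
case=> s [sB Xw].
have [|u [g gB gu] uw] := @mem_ideal_of_monomials
  (fun u => exists2 g, g \in B & is_lead le g u) w; last by exists g, u.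
exists s; split=> // c /sB[g [u [gB gu ->]]].
by exists u => //; exists g.
Qed.

Lemma is_lead_uniq f u v : is_lead le f u -> is_lead le f v -> u = v.
Proof.
case: to_le => anti _ _ _ _ [fu maxu] [fv maxv].
by apply: anti; rewrite maxu ?maxv.
Qed.

(** An element g of the basis whose leading monomial divides w, hence u, must
    be f itself, by reducedness. *)
Lemma reduced_lead_minimal f u h w : f \in B -> is_lead le f u ->
  I h -> is_lead le h w -> (w <= u)%MM -> w = u.
Proof.
move=> fB fu Ih hw wu; case: redB => _ _ red.
have [g [v [gB gv vw]]] := lead_divisible Ih hw.
have [eg|fg] := eqVneq f g; last first.
  by have := red _ _ _ _ fB gB fg gv fu.1; rewrite (lepm_trans vw wu).
rewrite -eg in gv; rewrite (is_lead_uniq gv fu) in vw.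
by apply/mnmP => k; apply/eqP; rewrite eqn_leq (mnm_lepP wu) (mnm_lepP vw).
Qed.

(** Reducedness excludes the leading monomials of the other elements of the
    basis; that of f itself cannot divide v, which is smaller. *)
Lemma reduced_tail_standard f u v h w : f \in B -> is_lead le f u ->
  v \in msupp f -> v != u -> I h -> is_lead le h w -> ~~ (w <= v)%MM.
Proof.
move=> fB fu fv vu Ih hw; case: redB => _ _ red.
have [g [t [gB gt tw]]] := lead_divisible Ih hw.
apply/negP => wv; have tv := lepm_trans tw wv.
have [eg|fg] := eqVneq f g; last first.
  by have := red _ _ _ _ fB gB fg gt fv; rewrite tv.
rewrite -eg in gt; rewrite (is_lead_uniq gt fu) in tv.
case: to_le => anti _ _ _ _; case/eqP: vu; apply: anti.
by rewrite fu.2 // lem_term_order.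
Qed.

Lemma binomial_lead u v : u != v ->
  is_lead le ('X_[u] - 'X_[v] : {mpoly K[N]}) u \/
  is_lead le ('X_[u] - 'X_[v] : {mpoly K[N]}) v.
Proof.
move=> uv; case: to_le => _ _ tot _ _.
have supp w : (w \in msupp ('X_[u] - 'X_[v] : {mpoly K[N]})) = (w \in [:: u; v]).
  rewrite mcoeff_msupp mcoeffB !mcoeffX !inE [w == u]eq_sym [w == v]eq_sym.
  case: (eqVneq u w) => [<-|_]; first by rewrite [v == u]eq_sym (negPf uv) subr0 oner_eq0.
  by case: (v == w); rewrite ?sub0r ?oppr_eq0 ?oner_eq0 ?subr0 ?eqxx.
have lexx w : le w w by have := tot w w; rewrite orbb.
have /orP[luv|lvu] := tot u v; [right | left]; split.
- by rewrite supp !inE eqxx orbT.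
- by move=> w; rewrite supp !inE => /orP[] /eqP ->.
- by rewrite supp !inE eqxx.
- by move=> w; rewrite supp !inE => /orP[] /eqP ->.
Qed.
End ReducedGroebner.

(** * The edge ideal is spanned by the fine-homogeneous binomials *)

Section EdgeIdeal.
Local Open Scope ring_scope.
Variables (K : fieldType) (n : nat) (G : sgraph n).
Local Notation N := #|{: var G}|.
Implicit Types (u v w : 'X_{1..N}) (i j : 'I_n).

Definition diag_pair i j : 'X_{1..N} :=
  (U_(enum_rank (Sub (i, i) (is_var_diag G i) : var G)) +
   U_(enum_rank (Sub (j, j) (is_var_diag G j) : var G)))%MM.

Definition edge_pair i j (e : G i j) : 'X_{1..N} :=
  (U_(enum_rank (Sub (i, j) (is_var_edge e) : var G)) +
   U_(enum_rank (Sub (j, i) (is_var_edge_sym e) : var G)))%MM.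

Lemma edge_minorE i j (e : G i j) :
  edge_minor K e = 'X_[diag_pair i j] - 'X_[edge_pair e].
Proof. by rewrite /edge_minor /x !mpolyXD. Qed.

Lemma expo_diag_pair i j k l :
  expo (diag_pair i j) k l = ((i == k) && (i == l) + (j == k) && (j == l))%N.
Proof. by rewrite expoD !expo1. Qed.

Lemma expo_edge_pair i j (e : G i j) k l :
  expo (edge_pair e) k l = ((i == k) && (j == l) + (j == k) && (i == l))%N.
Proof. by rewrite expoD !expo1. Qed.

Lemma fine_equiv_pairs i j (e : G i j) :
  fine_equiv (diag_pair i j) (edge_pair e).
Proof.
have sum1 (l : 'I_n) (b : bool) : (\sum_l' (b && (l == l') : nat) = b)%N.
  rewrite (bigD1 l) //= eqxx andbT big1 ?addn0 // => l' ll'.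
  by rewrite eq_sym (negPf ll') andbF.
apply/fine_equivP; split=> [k|k l].
  under eq_bigr do rewrite expo_diag_pair.
  under [in RHS]eq_bigr do rewrite expo_edge_pair.
  by rewrite !big_split /= !sum1.
rewrite !expo_diag_pair !expo_edge_pair.
by case: (i == k); case: (i == l); case: (j == k); case: (j == l).
Qed.

(** The sum of the coefficients over one fine degree is a linear functional
    that vanishes on every multiple of a generator, because the two monomials
    of a generator have the same fine degree. *)
Lemma PG_class_sum f u : PG K G f ->
  \sum_(w <- msupp f | fine_equiv u w) f@_w = 0.
Proof.
case=> s [sP ef].
pose phi w : K := (fine_equiv u w)%:R.
have -> : \sum_(w <- msupp f | fine_equiv u w) f@_w = weight phi f.
  rewrite big_mkcond; apply: eq_bigr => w _; rewrite /phi.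
  by case: (fine_equiv u w); rewrite ?mulr1 ?mulr0.
rewrite ef weight_sum big_seq big1 // => c /sP[i [j [e [_ ->]]]].
rewrite edge_minorE weight_binomial_multiple // => w; congr (_%:R).
have E : fine_equiv (w + diag_pair i j)%MM (w + edge_pair e)%MM.
  by rewrite ![(w + _)%MM]addmC fine_equivD fine_equiv_pairs.
by congr nat_of_bool; apply/idP/idP => /fine_equiv_trans; apply;
  rewrite // fine_equiv_sym.
Qed.

(** The standard monomials of P_G for a term order under which the leading
    terms of the generators are the products [x_ij * x_ji]. *)
Definition straight w : bool :=
  [forall i, forall j, G i j ==> (expo w i j == 0%N) || (expo w j i == 0%N)].

(** On an edge ij, one of the exponents of [x_ij] and [x_ji] vanishes, so
    their difference determines both; the row sums then determine the
    exponents of the diagonal variables. *)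
Lemma straight_uniq u v : straight u -> straight v -> fine_equiv u v -> u = v.
Proof.
move=> su sv uv; apply: (fine_equiv_edges_inj uv) => i j Gij.
have /fine_equivP[_ /(_ i j) dif] := uv.
have := forallP (forallP su i) j; have := forallP (forallP sv i) j.
by rewrite Gij /=; move: dif; lia.
Qed.

(** The degree in the variables [x_ij] with i and j distinct: it decreases at
    each rewriting of [x_ij * x_ji] into [x_ii * x_jj]. *)
Definition off_degree w : nat := \sum_i \sum_(j < n | j != i) expo w i j.

Lemma off_degreeD u v : off_degree (u + v)%MM = (off_degree u + off_degree v)%N.
Proof.
rewrite /off_degree -big_split; apply: eq_bigr => i _ /=.
by rewrite -big_split; apply: eq_bigr => j _; rewrite expoD.
Qed.

Lemma off_degree_diag i j : off_degree (diag_pair i j) = 0%N.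
Proof.
rewrite /off_degree big1 // => k _; rewrite big1 // => l lk.
have kl : k == l = false by rewrite eq_sym (negPf lk).
rewrite expo_diag_pair.
by case: (eqVneq i k) => [->|_]; case: (eqVneq j k) => [->|_]; rewrite ?kl.
Qed.

Lemma off_degree_edge i j (e : G i j) : (0 < off_degree (edge_pair e))%N.
Proof.
have ji : j != i by apply/eqP => ji; have := e; rewrite ji adj_irrefl.
by rewrite /off_degree (bigD1 i) //= (bigD1 j) //= expo_edge_pair !eqxx.
Qed.

Lemma straighten w : exists w',
  [/\ straight w', fine_equiv w w' & PG K G ('X_[w] - 'X_[w'])].
Proof.
have [d] := ubnP (off_degree w); elim: d w => // d IHd w.
rewrite ltnS => dw.
case: (boolP (straight w)) => [sw|].
  by exists w; rewrite fine_equiv_refl subrr; split=> //; apply: ideal_gen0.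
move=> nsw.
have [i [j [e [ij wij wji]]]] : exists i j (e : G i j),
    [/\ (i < j)%N, 0 < expo w i j & 0 < expo w j i]%N.
  have /existsP[i /forallPn[j]] : [exists i, ~~ [forall j, G i j ==>
      (expo w i j == 0%N) || (expo w j i == 0%N)]] by rewrite -negb_forall.
  rewrite negb_imply negb_or -!lt0n => /and3P[Gij wij wji].
  have [ij|ji|/val_inj ij] := ltngtP i j.
  - by exists i, j, Gij.
  - by have Gji := Gij; rewrite adj_sym in Gji; exists j, i, Gji.
  - by rewrite ij adj_irrefl in Gij.
have ew : (edge_pair e <= w)%MM.
  apply: lem_expo => k l; rewrite expo_edge_pair.
  have nij : i != j by rewrite -val_eqE neq_ltn ij.
  case: (eqVneq i k) => [<-|_]; case: (eqVneq j l) => [<-|_] //=.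
  - by rewrite eq_sym (negPf nij) addn0.
  - by rewrite [j == i]eq_sym (negPf nij).
  - by rewrite (negPf nij) andbF.
  - by case: eqP => [<-|//]; case: eqP => [<-|//].
pose w0 := (w - edge_pair e)%MM.
have Ew : w = (w0 + edge_pair e)%MM by rewrite submK.
have [|w' [sw' ww' Pw']] := IHd (w0 + diag_pair i j)%MM.
  apply: leq_trans dw; rewrite Ew (off_degreeD w0 (diag_pair i j)).
  rewrite (off_degreeD w0 (edge_pair e)) off_degree_diag.
  by rewrite addn0 -[X in (X < _)%N]addn0 ltn_add2l off_degree_edge.
exists w'; split=> //.
  apply: fine_equiv_trans ww'.
  by rewrite Ew ![(w0 + _)%MM]addmC fine_equivD fine_equiv_sym fine_equiv_pairs.
have -> : 'X_[w] - 'X_[w'] = 'X_[w0] * - edge_minor K e +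
    ('X_[w0 + diag_pair i j] - 'X_[w']) :> {mpoly K[N]}.
  by rewrite edge_minorE {1}Ew !mpolyXD opprB mulrBr addrA subrK.
apply: ideal_genD Pw'; apply/ideal_genM/ideal_genN/ideal_gen_mem.
by exists i, j, e.
Qed.

(** Both monomials rewrite modulo P_G to the same straight monomial. *)
Lemma PG_binomial u v : fine_equiv u v -> PG K G ('X_[u] - 'X_[v]).
Proof.
move=> uv; have [u' [su' uu' Pu]] := straighten u.
have [v' [sv' vv' Pv]] := straighten v.
have e : u' = v'.
  apply: straight_uniq => //; apply: fine_equiv_trans vv'.
  by apply: fine_equiv_trans uv; rewrite fine_equiv_sym.
have -> : 'X_[u] - 'X_[v] = ('X_[u] - 'X_[u']) + - ('X_[v] - 'X_[v']) :> {mpoly K[N]}.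
  by rewrite e opprB addrA subrK.
exact: ideal_genD Pu (ideal_genN Pv).
Qed.
End EdgeIdeal.

(** * The degree bound *)

Theorem corollary2p8 (K : fieldType) (n m : nat) (G : sgraph n)
    (hbip : bipartite G) (hm : #|edges G| = m)
    (f : {mpoly K[#|{: var G}|]})
    (hf : universal_groebner_basis (PG K G) f) :
  (deg f <= (m + n + 1) %/ 2)%N.
Proof.
have [le [B [tole redB fB]]] := hf.
have [[inI _] lead _] := redB.
have [u fu _] := lead f fB; have Pf := inI f fB.
have other w : w \in msupp f -> exists2 w', w' \in msupp f &
    w' != w /\ fine_equiv w w'.
  move=> fw; have [/hasP[w' fw' /andP[ne eq]]|/hasPn no] :=
    boolP (has (fun w' => (w' != w) && fine_equiv w w') (msupp f)).
    by exists w'.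
  have := PG_class_sum w Pf; rewrite big_mkcond (bigD1_seq w) ?msupp_uniq //=.
  rewrite fine_equiv_refl big1_seq => [|w' /andP[w'w /no]]; last first.
    by rewrite w'w /= => /negPf ->.
  by move/eqP; rewrite addr0 mcoeff_eq0 fw.
have equ w : w \in msupp f -> fine_equiv u w.
  (* Otherwise w shares its fine degree with another standard monomial. *)
  move=> fw; have [->|wu] := eqVneq w u; first exact: fine_equiv_refl.
  have [w' fw' [w'w ww']] := other w fw.
  have [eu|w'u] := eqVneq w' u; first by rewrite -eu fine_equiv_sym.
  have PX : PG K G ('X_[w] - 'X_[w'])%R by apply: PG_binomial.
  have ww'n : w != w' by rewrite eq_sym.
  case: (binomial_lead K tole ww'n) => lw.
    by have := reduced_tail_standard tole redB fB fu fw wu PX lw; rewrite lepm_refl.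
  by have := reduced_tail_standard tole redB fB fu fw' w'u PX lw; rewrite lepm_refl.
have [v fv [vu uv]] := other u fu.1.
have uvn : u != v by rewrite eq_sym.
have [u' [v' [u'u v'v u'v' neq deg_u']]] := conformal_pair hbip uv uvn.
have PX : PG K G ('X_[u'] - 'X_[v'])%R by apply: PG_binomial.
have {}u'u : u' = u.
  case: (binomial_lead K tole neq) => lw.
    exact: (reduced_lead_minimal tole redB fB fu PX lw u'u).
  by have := reduced_tail_standard tole redB fB fu fv vu PX lw; rewrite v'v.
rewrite {}u'u hm in deg_u'.
have deg_f : (deg f <= mdeg u)%N.
  rewrite /deg -subn1 leq_subLR add1n msizeE; apply/bigmax_leqP_seq => w fw _.
  by rewrite ltnS (mdeg_fine_equiv (equ w fw)).
by apply: leq_trans deg_f _; rewrite leq_divRL // muln2.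
Qed.
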